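(* Fix a positive integer $d$. Let $\mathcal{P}^d=(P_n^d)_{n=1}^{\infty}$ be the sequence of $d$-dimensional grids, where $P_n^d=(P_n)^d$ is the Cartesian product of $d$ paths on $n$ vertices each, and let $N=n^d$ be the number of vertices of $P_n^d$. Then every pebbling threshold function $\tau$ of $\mathcal{P}^d$ satisfies $$\tau\in \Omega\big(N2^{c_d(\lg N)^{1/(d+1)}}\big)\cap O\big(N2^{c'_d(\lg N)^{1/(d+1)}}\big)$$ for all $c_d<2^{-1/2d}$ and all $c'_d>d+1$.
   Context: Pebbling: a configuration of $t$ pebbles on a graph is a distribution of $t$ (indistinguishable) pebbles to its vertices. A pebbling step removes two pebbles from a vertex having at least two pebbles and places one pebble on a neighbor. A configuration is $r$-solvable if some sequence of pebbling steps places a pebble on vertex $r$, and solvable if it is $r$-solvable for every vertex $r$. For a graph on $N$ vertices, $\mathbf{C}_t$ denotes a configuration chosen uniformly at random among all $\binom{N+t-1}{t}$ configurations of $t$ pebbles. For a sequence $\mathcal{G}=(G_i)$ of graphs with strictly increasing numbers of vertices $N$, a function $\tau=\tau(N)$ is a pebbling threshold of $\mathcal{G}$ if for every function $\omega\to\infty$: $\Pr[\mathbf{C}_t\text{ is solvable}]\to 0$ when $t=\tau/\omega$, and $\Pr[\mathbf{C}_t\text{ is solvable}]\to 1$ when $t=\omega\tau$. Asymptotic notation ($O$, $\Omega$) is as $n\to\infty$; $\lg$ is the base-2 logarithm. *)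

(* Defs.v *)
From HB Require Import structures.
From mathcomp Require Import all_boot all_order all_algebra.
From mathcomp Require Import all_classical all_reals all_analysis.
Set Implicit Arguments.
Unset Strict Implicit.
Unset Printing Implicit Defensive.
Import Order.TTheory GRing.Theory Num.Theory.
Import numFieldNormedType.Exports.

Local Open Scope classical_set_scope.
Local Open Scope ring_scope.

Record sgraph := SGraph {
  vertex :> finType;
  adj : rel vertex;
  adj_sym : symmetric adj;
  adj_irr : irreflexive adj }.

Section PathGraph.
Variable n : nat.

Definition path_adj : rel 'I_n := fun i j => (i.+1 == j :> nat) || (j.+1 == i :> nat).

Lemma path_adj_sym : symmetric path_adj.
Proof. by move=> i j; rewrite /path_adj orbC. Qed.

Lemma path_adj_irr : irreflexive path_adj.
Proof. by move=> i; rewrite /path_adj orbb gtn_eqF. Qed.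

Definition path_graph : sgraph := SGraph path_adj_sym path_adj_irr.
End PathGraph.

Section CartesianPower.
Variables (G : sgraph) (d : nat).

Definition cart_adj : rel {ffun 'I_d -> G} := fun x y =>
  [exists k, adj (x k) (y k) && [forall j, (j != k) ==> (x j == y j)]].

Lemma cart_adj_sym : symmetric cart_adj.
Proof.
move=> x y; rewrite /cart_adj; apply: eq_existsb => k; rewrite adj_sym.
by congr andb; apply: eq_forallb => j; rewrite [x j == _]eq_sym.
Qed.

Lemma cart_adj_irr : irreflexive cart_adj.
Proof. by move=> x; apply/existsP => -[k]; rewrite adj_irr. Qed.

Definition cart_power : sgraph := SGraph cart_adj_sym cart_adj_irr.
End CartesianPower.

(* The term of index n = 0 is the empty graph when 0 < d; only limits as
   n -> oo of such sequences are considered. *)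
Definition grid (d n : nat) : sgraph := cart_power (path_graph n) d.

Section Pebbling.
Variable G : sgraph.

Definition config := {ffun G -> nat}.

Definition move_pebble (D : config) (u v : G) : config :=
  [ffun w => (D w - (w == u).*2 + (w == v))%N].

Definition pebbling_step : rel config := fun D D' =>
  [exists u, exists v, [&& adj u v, (2 <= D u)%N & D' == move_pebble D u v]].

Definition solvable_at (r : G) (D : config) : Prop :=
  exists s : seq config, path pebbling_step D s /\ (0 < last D s r)%N.

Definition solvable (D : config) : Prop := forall r : G, solvable_at r D.

(* Configurations of t pebbles, as a finite set: each vertex carries at most
   t pebbles. *)
Definition configs (t : nat) : {set {ffun G -> 'I_t.+1}} :=
  [set D : {ffun G -> 'I_t.+1} | (\sum_v D v)%N == t]%SET.

Definition to_config (t : nat) (D : {ffun G -> 'I_t.+1}) : config :=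
  [ffun v => nat_of_ord (D v)].

(* Probability that a uniformly random configuration of t pebbles is
   solvable. *)
Definition prob_solvable (R : realType) (t : nat) : R :=
  #|[set D in configs t | `[< solvable (to_config D) >]]%SET|%:R / #|configs t|%:R.
End Pebbling.

(* tau and omega are functions of the number of vertices N = #|G i|, and are
   rounded down to obtain a number of pebbles (Num.truncn is the floor, or 0
   on negative reals). *)
Definition pebbling_threshold (R : realType) (G : nat -> sgraph)
    (tau : nat -> R) : Prop :=
  forall omega : nat -> R, omega N @[N --> \oo] --> +oo ->
    prob_solvable (G i) R (Num.truncn (tau #|G i| / omega #|G i|))
      @[i --> \oo] --> (0 : R) /\
    prob_solvable (G i) R (Num.truncn (omega #|G i| * tau #|G i|))
      @[i --> \oo] --> (1 : R).

Definition lg (R : realType) (x : R) : R := ln x / ln 2.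

Definition grid_bound (R : realType) (d : nat) (c : R) (N : nat) : R :=
  N%:R * 2 `^ (c * (lg N%:R `^ (d.+1%:R)^-1)).

(* Main.v *)
Require Import Defs.
From HB Require Import structures.
From mathcomp Require Import all_boot all_order all_algebra.
From mathcomp Require Import all_classical all_reals all_analysis.
From mathcomp Require Import zify ring lra.
Set Implicit Arguments.
Unset Strict Implicit.
Unset Printing Implicit Defensive.
Import Order.TTheory GRing.Theory Num.Theory.
Import numFieldNormedType.Exports.
Local Open Scope classical_set_scope.
Local Open Scope ring_scope.

(** Write [L] for the [(d+1)]-st root of [lg N].

    Upper bound.  Let [s] exceed [L] by at most 1.  A vertex [r] lies in a box
    of side [s], all of whose vertices are at distance at most [d * s] from
    [r], so [r] is reachable as soon as one of these [s ^ d] vertices carries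
    [2 ^ (d * s)] pebbles.  With [N * 2 ^ ((d + 1) * s + 1)] pebbles this fails
    with probability at most [2 ^ - ((s + 1) * s ^ d)], since the number of
    configurations with prescribed values on [b] vertices is at most
    [(N / (N + t)) ^ b] times the number of all configurations.  As
    [N <= 2 ^ s ^ d.+1], a union bound over [r] suffices.

    Lower bound.  Up to a factor polynomial in [N], a uniform configuration is
    dominated by independent geometric variables of mean about [t / N].  The
    quantity "sum over v of [D v * 2 ^ - dist v r]" does not increase under
    pebbling steps, and is at least 1 once [r] has a pebble.  Cut the grid into
    disjoint blocks of side of order [L] with centres [r].  If
    [t <= N * 2 ^ l], a block is so sparse that the weight at its centre is
    below 1/2 with probability at least [2 ^ - l ^ d.+1] up to factors
    [2 ^ o(L ^ d.+1)], because the sum of [l - dist v r] over the vertices at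
    distance at most [l] from [r] is at most [l ^ d.+1]; vertices outside the
    block contribute less than 1/2 as no vertex has many more than [2 ^ l]
    pebbles.  When [l <= (1 - eps) * L] the blocks outnumber the inverse of
    this probability, so some centre is unreachable.  This yields the lower
    bound for every [c < 1].

    A threshold violating either bound would do so along a sequence, and an
    [omega] growing slowly enough along that sequence contradicts the
    definition of a threshold. *)

(** * Weights and reachability on an arbitrary graph *)

Definition pweight (R : realFieldType) (G : sgraph) (dist : G -> nat)
    (D : config G) : R := \sum_v (D v)%:R * 2^-1 ^+ dist v.

(** A step from [u] to [v] loses [2 * 2^-1 ^+ dist u] and gains [2^-1 ^+ dist v]; the loss is at
    least the gain because [dist] drops by at most 1 along the edge. *)
Lemma pweight_step (R : realFieldType) (G : sgraph) (dist : G -> nat)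
    (D D' : config G) :
  (forall u v, adj u v -> (dist u <= (dist v).+1)%N) ->
  pebbling_step D D' -> pweight R dist D' <= pweight R dist D.
Proof.
move=> hdist /existsP[u /existsP[v /and3P[huv hu /eqP ->]]].
have E w : (move_pebble D u v w)%:R * 2^-1 ^+ dist w
  = (D w)%:R * 2^-1 ^+ dist w
    - (if w == u then 2 * 2^-1 ^+ dist u else 0)
    + (if w == v then 2^-1 ^+ dist v else 0) :> R.
  rewrite ffunE natrD natrB; last by case: eqP => [->|] /=; lia.
  rewrite -muln2 natrM.
  by case: (eqVneq w u) => [->|_]; case: (eqVneq _ v) => [->|_] /=; ring.
rewrite /pweight (eq_bigr _ (fun w _ => E w)) big_split /= sumrB.
rewrite -!big_mkcond !big_pred1_eq /= -addrA gerDl addrC subr_le0.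
apply: (@le_trans _ _ (2 * 2^-1 ^+ (dist v).+1)).
  by rewrite exprS; lra.
by rewrite ler_pM2l ?ltr0n// ler_wiXn2l ?hdist//; lra.
Qed.

Lemma solvable_at_pweight (R : realFieldType) (G : sgraph) (dist : G -> nat)
    (D : config G) (r : G) :
  (forall u v, adj u v -> (dist u <= (dist v).+1)%N) -> dist r = 0%N ->
  solvable_at r D -> 1 <= pweight R dist D.
Proof.
move=> hdist hr [s [hs hl]].
apply: (@le_trans _ _ (pweight R dist (last D s))).
  rewrite /pweight (bigD1 r) //= hr expr0 mulr1 ler_wpDr ?ler1n//.
  by apply: sumr_ge0 => v _; rewrite mulr_ge0// exprn_ge0// invr_ge0.
elim: s D hs {hl} => [//|D' s IH] D /= /andP[hD /IH].
by move/le_trans; apply; apply: pweight_step.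
Qed.

Lemma move_pebbles (G : sgraph) (u v : G) (m : nat) (D : config G) :
  adj u v -> (m.*2 <= D u)%N ->
  exists s, path (@pebbling_step G) D s /\ (m <= last D s v)%N.
Proof.
move=> huv; have nuv : u != v by apply: contraTneq huv => ->; rewrite adj_irr.
(* Counting the pebbles already on [v] lets the induction on [m] accumulate them. *)
suff H : (m.*2 <= D u)%N ->
    exists s, path (@pebbling_step G) D s /\ (D v + m <= last D s v)%N.
  by case/H => s [hs hl]; exists s; split=> //; apply: leq_trans hl; rewrite leq_addl.
elim: m D => [|m IH] D hD; first by exists [::]; rewrite /= addn0.
have [] := IH (move_pebble D u v); first by rewrite ffunE eqxx (negbTE nuv); lia.
move=> s [hs hl]; exists (move_pebble D u v :: s); split.
  rewrite /= hs andbT; apply/existsP; exists u; apply/existsP; exists v.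
  by rewrite huv eqxx; apply/andP; split=> //; lia.
apply: leq_trans hl; rewrite ffunE eqxx [v == u]eq_sym (negbTE nuv); lia.
Qed.

(** Each move to a neighbour closer to [r] halves the pile, so [2 ^ dist v] pebbles leave one at
    [r]. *)
Lemma solvable_at_pow2 (G : sgraph) (dist : G -> nat) (r v : G) (D : config G) :
  (forall u, dist u = 0%N -> u = r) ->
  (forall u k, dist u = k.+1 -> exists2 w, adj u w & dist w = k) ->
  (2 ^ dist v <= D v)%N -> solvable_at r D.
Proof.
move=> h0 hS; move E : (dist v) => k; elim: k v E D => [|k IH] v E D hD.
  by exists [::]; rewrite /= -(h0 v E).
have [w vw Ew] := hS _ _ E.
have [s [hs hl]] : exists s, path (@pebbling_step G) D s /\ (2 ^ k <= last D s w)%N.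
  by apply: move_pebbles vw _; rewrite -mul2n -expnS.
have [s' [hs' hl']] := IH _ Ew _ hl.
by exists (s ++ s'); rewrite cat_path last_cat hs.
Qed.

(** * The [l1] metric on grids *)

(** One of the two truncated differences is 0, so each summand is an absolute difference. *)
Definition l1dist d n (x y : {ffun 'I_d -> 'I_n}) : nat :=
  (\sum_i ((x i - y i) + (y i - x i)))%N.

Lemma l1dist_eq0 d n (x y : {ffun 'I_d -> 'I_n}) : l1dist x y = 0%N -> x = y.
Proof.
move=> /eqP; rewrite sum_nat_eq0 => /forallP h; apply/ffunP => i; apply: val_inj.
by have := h i; rewrite implyTb /=; lia.
Qed.

Lemma l1distxx d n (x : {ffun 'I_d -> 'I_n}) : l1dist x x = 0%N.
Proof. by apply: big1 => i _; lia. Qed.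

Lemma l1dist_adj d n (u v r : grid d n) :
  adj u v -> (l1dist u r <= (l1dist v r).+1)%N.
Proof.
move=> /existsP[k /andP[huv /forallP hne]].
rewrite /l1dist (bigD1 k) //= [in leqRHS](bigD1 k) //= -addSn leq_add//.
  by move: huv; rewrite /= /path_adj; case/orP=> /eqP; lia.
by apply: leq_sum => j jk; have := hne j; rewrite jk /= => /eqP ->.
Qed.

(** Any coordinate where [v] and [r] differ can be moved one unit towards [r]. *)
Lemma l1dist_descent d n (v r : grid d n) k :
  l1dist v r = k.+1 -> exists2 w, adj v w & l1dist w r = k.
Proof.
move=> E; have [i hi] : exists i, v i != r i.
  apply/existsP; rewrite -negb_forall; apply/negP => /forallP h.
  suff vr : v = r by rewrite vr l1distxx in E.
  by apply/ffunP => i; apply/eqP.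
have {}hi : v i != r i :> nat by [].
have hw : ((if (v i < r i)%N then (v i).+1 else (v i).-1) < n)%N.
  by have := ltn_ord (v i); have := ltn_ord (r i); case: ifP; lia.
exists [ffun j => if j == i then Ordinal hw else v j].
  apply/existsP; exists i; rewrite ffunE eqxx; apply/andP; split.
    rewrite /= /path_adj /=.
    case: (ltnP (v i) (r i)) => h; apply/orP; [by left|right].
    by apply/eqP/prednK; apply: leq_ltn_trans (leq0n (r i)) _; rewrite ltn_neqAle eq_sym hi.
  by apply/forallP => j; apply/implyP => ji; rewrite ffunE (negbTE ji).
move: E; rewrite /l1dist (bigD1 i) //= [in X in _ -> X](bigD1 i) //= ffunE eqxx /=.
rewrite [in X in _ -> X](eq_bigr (fun j => (v j - r j + (r j - v j))%N)).
  move: hi; move: (v i : nat) (r i : nat) (\sum_(_ | _) _)%N => a b S hi.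
  by case: ltnP; lia.
by move=> j ji; rewrite ffunE (negbTE ji).
Qed.

(** * Counting configurations *)

(** Stars and bars, transported from tuples to functions by [fgraph]. *)
Lemma card_ffun_sum_eq (T : finType) (t : nat) : (0 < #|T|)%N ->
  #|[set f : {ffun T -> 'I_t.+1} | (\sum_x f x)%N == t]%SET|
    = 'C(#|T|.-1 + t, t).
Proof.
case E : #|T| => [//|m] _ /=.
rewrite -[RHS]bin_sub ?leq_addl// addnK -(card_ord_partitions m t) -E.
rewrite -!sum1dep_card (reindex (@fgraph T 'I_t.+1)) /=; last first.
  by apply: onW_bij; exists (@Finfun _ _); [exact: fgraphK|exact: FinfunK].
by apply: eq_bigl => f; rewrite /= codomE big_map big_enum.
Qed.

Lemma card_ffun_sum_le (T : finType) (t : nat) :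
  #|[set f : {ffun T -> 'I_t.+1} | (\sum_x f x <= t)%N]%SET| = 'C(#|T| + t, t).
Proof.
rewrite -[RHS]bin_sub ?leq_addl// addnK -(card_partial_ord_partitions #|T| t).
rewrite -!sum1dep_card (reindex (@fgraph T 'I_t.+1)) /=; last first.
  by apply: onW_bij; exists (@Finfun _ _); [exact: fgraphK|exact: FinfunK].
by apply: eq_bigl => f; rewrite /= codomE big_map big_enum.
Qed.

(* All values of such a function are determined by its values on [B] and on
   the complement of [B] minus one point. *)
Lemma card_ffun_sum_lt_on (T : finType) (B : {set T}) (m t : nat) :
  (0 < m)%N -> (#|B| < #|T|)%N ->
  (#|[set f : {ffun T -> 'I_t.+1} | ((\sum_x f x)%N == t)
      && [forall x in B, (f x < m)%N]]%SET|
    <= m ^ #|B| * 'C(#|T|.-1 - #|B| + t, t))%N.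
Proof.
move=> m0 hB; have [v0 hv0] : exists v0, v0 \notin B.
  apply/existsP; rewrite -negb_forall; apply: contraTN hB => /forallP h.
  by rewrite -leqNgt -cardsT subset_leq_card//; apply/fintype.subsetP => x _; exact: h.
case: m m0 => // m _.
pose A := (~: B :\ v0)%SET.
have hA : #|A| = (#|T|.-1 - #|B|)%N.
  have := cardsC B; have := cardsD1 v0 (~: B)%SET; rewrite inE hv0 -/A; lia.
pose S := [set f : {ffun T -> 'I_t.+1} | ((\sum_x f x)%N == t)
      && [forall x in B, (f x < m.+1)%N]]%SET.
pose h (f : {ffun T -> 'I_t.+1}) :
    {ffun {x | x \in B} -> 'I_m.+1} * {ffun {x | x \in A} -> 'I_t.+1} :=
  ([ffun x => inord (f (val x))], [ffun x => f (val x)]).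
have sumA (f : {ffun T -> 'I_t.+1}) :
    (\sum_(x : {x | x \in A}) f (val x) = \sum_(x in A) f x)%N.
  exact/esym/(big_sub (mem A)).
have sumT (f : {ffun T -> 'I_t.+1}) :
    (\sum_x f x = f v0 + \sum_(x in A) f x + \sum_(x in B) f x)%N.
  rewrite (bigID (fun x => x \in B)) /= addnC (bigD1 v0) //=; congr (_ + _ + _)%N.
  by apply: eq_bigl => x; rewrite !inE andbC.
have hinj : {in S &, injective h}.
  move=> f g /[!inE] /andP[/eqP sf /forall_inP fB] /andP[/eqP sg /forall_inP gB] [e1 e2].
  have eB x : x \in B -> f x = g x.
    move=> xB; have /ffunP/(_ (exist _ x xB)) := e1; rewrite !ffunE /=.
    move/(congr1 val); rewrite /= !inordK ?fB ?gB// => e; exact: val_inj.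
  have eA x : x \in A -> f x = g x.
    by move=> xA; have /ffunP/(_ (exist _ x xA)) := e2; rewrite !ffunE.
  have e0 : f v0 = g v0.
    apply: val_inj => /=; move: sf sg; rewrite !sumT.
    have -> : (\sum_(x in A) f x = \sum_(x in A) g x)%N by apply: eq_bigr => x /eA ->.
    have -> : (\sum_(x in B) f x = \sum_(x in B) g x)%N by apply: eq_bigr => x /eB ->.
    move=> sf sg; move/eqP: (etrans sf (esym sg)); rewrite !eqn_add2r => /eqP.
    exact.
  apply/ffunP => x; case: (boolP (x \in B)) => [/eB//|xB].
  case: (eqVneq x v0) => [->//|xv]; apply: eA.
  by rewrite !inE xv.
rewrite -/S -(card_in_imset hinj).
have <- : #|finset.setX [set: {ffun {x | x \in B} -> 'I_m.+1}]%SET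
    [set g : {ffun {x | x \in A} -> 'I_t.+1} | (\sum_x g x <= t)%N]%SET|
    = (m.+1 ^ #|B| * 'C(#|T|.-1 - #|B| + t, t))%N.
  by rewrite finset.cardsX cardsT card_ffun card_ord card_ffun_sum_le !card_sig hA.
apply: subset_leq_card; apply/fintype.subsetP => _ /imsetP[f /[!inE] /andP[/eqP sf _] ->].
rewrite /= (eq_bigr (fun x : {x | x \in A} => nat_of_ord (f (val x)))).
  rewrite sumA; move: sf; rewrite sumT; lia.
by move=> x _; rewrite ffunE.
Qed.

(** Passing from ['C(M.+1 + t, t)] to ['C(M + t, t)] costs the factor [M.+1 / (M.+1 + t)], which is
    at most [N / (N + t)] as long as [M.+1 <= N]. *)
Lemma bin_ratio_le (N t b : nat) : (b < N)%N ->
  ('C(N.-1 - b + t, t) * (N + t) ^ b <= N ^ b * 'C(N.-1 + t, t))%N.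
Proof.
elim: b => [|b IH] hb; first by rewrite subn0 !expn0 muln1 mul1n.
apply: leq_trans (_ : N * ('C(N.-1 - b + t, t) * (N + t) ^ b) <= _)%N; last first.
  by rewrite expnS -mulnA leq_mul2l IH ?orbT// ltnW.
rewrite expnS !mulnA leq_mul2r; apply/orP; right.
have [M eM hM] : exists2 M, (N.-1 - b = M.+1)%N & (M.+1 <= N)%N.
  by exists (N.-1 - b.+1)%N; lia.
have -> : (N.-1 - b.+1 = M)%N by lia.
rewrite eM; have := mul_bin_down (M.+1 + t) t; rewrite addnK /= => E.
rewrite -(@leq_pmul2r M.+1)// -[leqRHS]mulnA [(_ * M.+1)%N in leqRHS]mulnC -E.
rewrite [leqLHS]mulnAC mulnA -[leqLHS]mulnA [leqRHS]mulnC leq_mul2l; apply/orP; right.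
nia.
Qed.

(** * Upper bound: boxes and the union bound *)

Lemma card_grid d n : #|grid d n| = (n ^ d)%N.
Proof. by rewrite card_ffun !card_ord. Qed.

Lemma leq_card_bigcup (I T : finType) (S : I -> {set T}) :
  (#|\bigcup_i S i|%SET <= \sum_i #|S i|)%N.
Proof.
apply: (big_ind2 (fun (X : {set T}) m => (#|X| <= m)%N)) => // [|X m Y k hX hY].
  by rewrite cards0.
by apply: leq_trans (leq_card_setU X Y) (leq_add hX hY).
Qed.

Lemma grid_corner_box d n s (r : grid d n) : (0 < s)%N -> (s <= n)%N ->
  exists2 B : {set grid d n}, #|B| = (s ^ d)%N &
    forall v, v \in B -> (l1dist v r <= d * s)%N.
Proof.
(* The lower corner is pulled back near the far faces, so that the box contains [r] and stays inside
   the grid. *)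
move=> s0 sn; pose a i := minn (r i) (n - s).
have ha i (k : 'I_s) : (a i + k < n)%N.
  by have := ltn_ord k; have := ltn_ord (r i); rewrite /a; lia.
pose h (g : {ffun 'I_d -> 'I_s}) : {ffun 'I_d -> 'I_n} :=
  [ffun i => Ordinal (ha i (g i))].
exists (h @: [set: {ffun 'I_d -> 'I_s}])%SET.
  rewrite card_imset ?cardsT ?card_ffun ?card_ord// => f g /ffunP e.
  apply/ffunP => i; apply: val_inj; have := e i; rewrite !ffunE => -[] /addnI; exact.
move=> _ /imsetP[g _ ->].
have -> : (d * s = \sum_(i < d) s)%N by rewrite sum_nat_const card_ord.
apply: leq_sum => i _; rewrite ffunE /= /a.
have := ltn_ord (g i); have := ltn_ord (r i).
move: (nat_of_ord (g i)) (nat_of_ord (r i)) => x y; lia.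
Qed.

Lemma prob_solvable_grid_ge (R : realType) d n s t :
  (0 < d)%N -> (0 < s)%N -> (s < n)%N -> (n ^ d <= 2 ^ s ^ d.+1)%N ->
  (n ^ d * 2 ^ (d.+1 * s + 1) <= t)%N ->
  1 / 2 <= prob_solvable (grid d n) R t.
Proof.
move=> d0 s0 sn hn ht; set N := (n ^ d)%N in hn ht.
have N0 : (0 < N)%N by rewrite expn_gt0; apply/orP; left; lia.
set b := (s ^ d)%N; have bN : (b < N)%N by rewrite ltn_exp2r.
have b0 : (0 < b)%N by rewrite expn_gt0 s0.
set C := configs (grid d n) t.
have cC : #|C| = 'C(N.-1 + t, t) by rewrite /C card_ffun_sum_eq card_grid.
pose A := [set D in C | `[< solvable (to_config D) >]]%SET.
rewrite /prob_solvable -/C -/A.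
suff hU : (#|C :\: A|.*2 <= #|C|)%N.
  have C0 : (0 < #|C|)%N by rewrite cC bin_gt0 leq_addl.
  have AC : A \subset C by apply/fintype.subsetP => D; rewrite inE => /andP[].
  have := cardsID A C; rewrite (finset.setIidPr AC) => e.
  rewrite ler_pdivlMr ?ltr0n// mulrC mulrA mulr1 ler_pdivrMr ?ltr0n//.
  by rewrite -natrM ler_nat; lia.
have hB r : exists2 B : {set grid d n}, #|B| = (s ^ d)%N &
    forall v, v \in B -> (l1dist v r <= d * s)%N by exact: grid_corner_box (ltnW sn).
(* If [r] is unreachable, no vertex of its box has [2 ^ (d * s)] pebbles; these events cover the
   unsolvable configurations. *)
pose S r := [set D : {ffun grid d n -> 'I_t.+1} | ((\sum_x D x)%N == t)
      && [forall x in s2val (cid2 (hB r)), (D x < 2 ^ (d * s))%N]]%SET.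
have UC : (#|C :\: A| <= N * (2 ^ (d * s * b) * 'C(N.-1 - b + t, t)))%N.
  apply: (@leq_trans (\sum_r #|S r|)).
    apply: leq_trans (leq_card_bigcup S); apply: subset_leq_card.
    apply/fintype.subsetP => D; rewrite !inE.
    move=> /andP[+ hD]; rewrite hD /= => /asboolP /existsNP[r hr].
    apply/finset.bigcupP; exists r => //; rewrite inE hD /=.
    apply/forall_inP => x xB; rewrite ltnNge; apply/negP => hx; apply: hr.
    apply: (@solvable_at_pow2 (grid d n) (fun v => @l1dist d n v r) r x (to_config D)).
    - by move=> u; exact: l1dist_eq0.
    - by move=> u k; exact: l1dist_descent.
    - rewrite ffunE; apply: leq_trans hx; rewrite leq_exp2l//.
      exact: (s2valP' (cid2 (hB r))).
  rewrite -[N]card_grid -sum_nat_const; apply: leq_sum => r _; rewrite expnM.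
  rewrite -[b](s2valP (cid2 (hB r))) card_grid -/N -[N]card_grid.
  apply: card_ffun_sum_lt_on; first by rewrite expn_gt0.
  by rewrite (s2valP (cid2 (hB r))) card_grid.
have hR := bin_ratio_le t bN.
have Nb0 : (0 < N ^ b)%N by rewrite expn_gt0 N0.
rewrite cC -(leq_pmul2r Nb0) mulnC.
rewrite [leqRHS]mulnC; apply: leq_trans hR.
apply: leq_trans (_ : N ^ b * (N * (2 ^ (d * s * b) * 'C(N.-1 - b + t, t))).*2 <= _)%N.
  by rewrite leq_mul2l leq_double UC orbT.
apply: leq_trans (_ : 'C(N.-1 - b + t, t) * (N * 2 ^ (d.+1 * s + 1)) ^ b <= _)%N; last first.
  by rewrite leq_mul2l leq_exp2r// (leq_trans ht) ?leq_addl ?orbT.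
rewrite expnMn -muln2 [leqRHS]mulnCA leq_mul2l; apply/orP; right.
rewrite [leqLHS](_ : _ = 'C(N.-1 - b + t, t) * (N * (2 ^ (d * s * b) * 2)))%N; last by ring.
rewrite leq_mul2l; apply/orP; right.
(* The exponent [s * b + d * s * b + 1] is at most [(d.+1 * s + 1) * b] since [b >= 1]; the summand
   1 in [d.+1 * s + 1] pays for the factor 2. *)
apply: leq_trans (_ : 2 ^ s ^ d.+1 * 2 ^ (d * s * b).+1 <= _)%N.
  by rewrite leq_mul// expnS mulnC.
rewrite -expnD -expnM leq_exp2l// expnS -/b; nia.
Qed.

(** * Independence over disjoint blocks *)

(** Under a product measure, functions of disjoint blocks are independent. Both sides are expanded
    over the subsets [S] of [J]; each term then factors over the vertices, because a vertex meets at
    most one block of [S]. *)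
Lemma sum_prod_disjoint_blocks (R : comNzRingType) (T I J : finType)
    (B : J -> {set T}) (F g : T -> I -> R) :
  (forall v, \sum_i F v i = 1) ->
  (forall j k v, v \in B j -> v \in B k -> j = k) ->
  \sum_(D : {ffun T -> I})
      (\prod_v F v (D v)) * \prod_j (1 - \prod_(v in B j) g v (D v))
    = \prod_j (1 - \prod_(v in B j) \sum_i F v i * g v i).
Proof.
move=> F1 hB.
have E (a : J -> R) : \prod_j (1 - a j)
    = \sum_(S : {set J}) (-1) ^+ #|S| * \prod_(j in S) a j.
  rewrite (eq_bigr (fun j => - a j + 1)); last by move=> j _; rewrite addrC.
  rewrite bigA_distr; apply: eq_bigr => S _.
  by rewrite -big_mkcond prodrN.
rewrite [RHS]E; under eq_bigr => D _ do rewrite E mulr_sumr.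
rewrite exchange_big; apply: eq_bigr => S _ /=.
under eq_bigr do rewrite mulrCA.
rewrite -mulr_sumr; congr (_ * _).
transitivity (\sum_(D : {ffun T -> I})
    \prod_v (F v (D v) * \prod_(j in S | v \in B j) g v (D v))).
  apply: eq_bigr => D _; rewrite big_split /=; congr (_ * _).
  by rewrite (exchange_big_dep xpredT).
rewrite -(bigA_distr_bigA (fun v i => F v i * \prod_(j in S | v \in B j) g v i)).
rewrite (exchange_big_dep xpredT) //=; apply: eq_bigr => v _.
(* A vertex in no block of [S] contributes its total mass 1. *)
case: (pickP (fun j => (j \in S) && (v \in B j))) => [j /andP[jS vj]|h].
  have e k : (k \in S) && (v \in B k) = (k == j).
    by apply/andP/eqP => [[_ /hB/(_ vj)]|->].
  by rewrite (big_pred1 j)//; apply: eq_bigr => i _; rewrite (big_pred1 j).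
rewrite [RHS]big_pred0// -[RHS](F1 v); apply: eq_bigr => i _.
by rewrite big_pred0// mulr1.
Qed.

(** The marginal of one coordinate, from the preceding lemma with the single block [{v}]. *)
Lemma sum_prod_one_coord (R : comNzRingType) (T I : finType) (F : T -> I -> R)
    (g : I -> R) (v : T) :
  (forall v, \sum_i F v i = 1) ->
  \sum_(D : {ffun T -> I}) (\prod_w F w (D w)) * g (D v) = \sum_i F v i * g i.
Proof.
move=> F1.
have := @sum_prod_disjoint_blocks R T I unit (fun=> [set v]%SET) F (fun=> g) F1.
move/(_ (fun j k _ _ _ => match j, k with tt, tt => erefl end)).
have e (f : unit -> R) : \prod_j f j = f tt by rewrite (big_pred1 tt) => [|[]].
rewrite e big_set1; under eq_bigr => D _ do rewrite e big_set1 mulrBr mulr1.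
rewrite sumrB -(bigA_distr_bigA F) big1 ?mulr1// => /addrI /oppr_inj; exact.
Qed.

(** * From uniform configurations to geometric variables *)

(** The ratio [a k.+1 / a k] equals [(n - k) * t / (k.+1 * u)], which is at least 1 for [k < t] and
    at most 1 from [t] on. *)
Lemma binomial_mode (t u k : nat) : (k <= t + u)%N ->
  ('C(t + u, k) * t ^ k * u ^ (t + u - k) <= 'C(t + u, t) * t ^ t * u ^ u)%N.
Proof.
set n := (t + u)%N; pose a k := ('C(n, k) * t ^ k * u ^ (n - k))%N.
have -> : ('C(n, t) * t ^ t * u ^ u = a t)%N by rewrite /a /n addKn.
rewrite -/(a k) => kn.
(* If [u] or [t] is 0, only the term [k = t] is nonzero. *)
case: (posnP u) => [u0|u0].
  case: (ltnP k n) => h; first by rewrite /a u0 exp0n ?muln0//; lia.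
  by have -> : k = t by lia.
case: (posnP t) => [t0|t0].
  case: (posnP k) => h; first by have -> : k = t by lia.
  by rewrite /a t0 exp0n// muln0.
have step i : (i < n)%N -> (i.+1 * u * a i.+1 = (n - i) * t * a i)%N.
  move=> hi; rewrite /a -(@subnSK i n)// [(t ^ i.+1)%N]expnS [(u ^ _.+1)%N]expnS.
  have := mul_bin_left n i; move: ('C(n, i.+1)) ('C(n, i)) => x y e.
  rewrite -(@subnSK i n)// in e.
  rewrite [LHS](_ : _ = (i.+1 * x) * (t * t ^ i * (u * u ^ (n - i.+1))))%N; last by ring.
  by rewrite e; ring.
have up i : (i < t)%N -> (a i <= a i.+1)%N.
  move=> it; have it' : (i < n)%N by lia.
  have := step i it'; have p : (0 < (n - i) * t)%N by rewrite muln_gt0; lia.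
  move=> e; rewrite -(leq_pmul2l p) -e leq_mul2r; apply/orP; right; nia.
have dn i : (t <= i)%N -> (i < n)%N -> (a i.+1 <= a i)%N.
  move=> it hi; have := step i hi.
  have p : (0 < i.+1 * u)%N by rewrite muln_gt0.
  move=> e; rewrite -(leq_pmul2l p) e leq_mul2r; apply/orP; right; nia.
case: (leqP k t) => kt.
  rewrite -(subKn kt); elim: (t - k)%N (leq_subr k t) => [|j IH] hj; first by rewrite subn0.
  apply: leq_trans (IH (ltnW hj)); have <- : (t - j.+1).+1 = (t - j)%N by lia.
  by apply: up; lia.
have [j ek] : exists j, k = (t + j)%N by exists (k - t)%N; lia.
rewrite ek in kn *; elim: j kn {ek kt} => [|j IH] hj; first by rewrite addn0.
by apply: leq_trans (IH _); rewrite ?addnS ?dn//; lia.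
Qed.

(** The binomial expansion has [(t + u).+1] terms, none above the modal one. *)
Lemma expn_self_le (t u : nat) :
  ((t + u) ^ (t + u) <= (t + u).+1 * ('C(t + u, t) * t ^ t * u ^ u))%N.
Proof.
have := expnDn u t (t + u); rewrite {1}addnC => ->.
rewrite -[(t + u).+1 in leqRHS]card_ord -sum_nat_const.
apply: leq_sum => i _; rewrite mulnA mulnAC.
by rewrite binomial_mode// -ltnS.
Qed.

(** The geometric law of ratio [x], cut off at [t] and normalised to match values in ['I_t.+1]. *)
Definition geom (R : realFieldType) (t : nat) (x : R) (i : 'I_t.+1) : R :=
  x ^+ i / \sum_(j < t.+1) x ^+ j.

Lemma geom_norm_gt0 (R : realFieldType) (t : nat) (x : R) : 0 <= x ->
  0 < \sum_(j < t.+1) x ^+ j.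
Proof.
move=> x0; rewrite big_ord_recl expr0 ltr_pwDl//.
by apply: sumr_ge0 => i _; apply: exprn_ge0.
Qed.

Lemma geom_ge0 (R : realFieldType) (t : nat) (x : R) (i : 'I_t.+1) :
  0 <= x -> 0 <= geom x i.
Proof. by move=> x0; rewrite divr_ge0 ?exprn_ge0// ltW// geom_norm_gt0. Qed.

Lemma sum_geom (R : realFieldType) (t : nat) (x : R) : 0 <= x ->
  \sum_(i < t.+1) geom x i = 1.
Proof. by move=> x0; rewrite -mulr_suml divff// gt_eqF// geom_norm_gt0. Qed.

Lemma geom_tail (R : realFieldType) (t : nat) (x : R) (m : nat) : 0 <= x ->
  \sum_(i < t.+1) geom x i * (m <= i)%:R <= x ^+ m.
Proof.
move=> x0; rewrite (eq_bigr (fun i : 'I_t.+1 =>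
    (if (m <= i)%N then x ^+ i else 0) / \sum_(j < t.+1) x ^+ j)); last first.
  by move=> i _; rewrite /geom; case: leqP; rewrite ?mulr1 ?mulr0 ?mul0r.
rewrite -mulr_suml ler_pdivrMr ?geom_norm_gt0// -big_mkcond /=.
rewrite -(big_geq_mkord m t.+1 xpredT (fun i => x ^+ i)) -{1}[m]add0n big_addn.
rewrite (eq_bigr (fun i => x ^+ m * x ^+ i)); last by move=> i _; rewrite exprD mulrC.
rewrite -mulr_sumr ler_wpM2l ?exprn_ge0// -(big_mkord xpredT (fun i => x ^+ i)).
rewrite (@big_cat_nat _ _ _ (t.+1 - m)%N 0%N t.+1) ?leq_subr//= lerDl.
by apply: sumr_ge0 => i _; apply: exprn_ge0.
Qed.

Lemma geom_head (R : realFieldType) (t : nat) (x : R) (m : nat) : 0 <= x ->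
  1 - x ^+ m <= \sum_(i < t.+1) geom x i * (i < m)%:R.
Proof.
move=> x0; rewrite lerBlDr -[leLHS](sum_geom t x0).
rewrite -lerBlDl -sumrB; apply: le_trans (geom_tail t m x0).
by apply: ler_sum => i _; case: ltnP; rewrite ?mulr1 ?mulr0 ?subrr ?subr0.
Qed.

(* [x] makes [t] the mode of the number of pebbles, hence only a polynomial
   factor is lost by passing to independent geometric variables. *)
Lemma card_configs_ratio_le (R : realFieldType) (G : sgraph) (t : nat)
    (E : {set {ffun G -> 'I_t.+1}}) (x := t%:R / (#|G|.-1 + t)%:R : R) :
  (1 < #|G|)%N -> E \subset configs G t ->
  #|E|%:R / #|configs G t|%:R
    <= (#|G| + t)%:R ^+ 2 * \sum_(D in E) \prod_v geom x (D v).
Proof.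
move=> hN /fintype.subsetP hE; rewrite {}/x; set N := #|G| in hN *.
set u := N.-1; set n := (u + t)%N; set x := t%:R / n%:R.
have u0 : (0 < u)%N by rewrite /u; lia.
have n0 : 0 < n%:R :> R by rewrite ltr0n /n; lia.
have x0 : 0 <= x by rewrite divr_ge0.
have x1 : 1 - x = u%:R / n%:R.
  by rewrite /x -[X in X - _](divff (lt0r_neq0 n0)) -mulrBl /n natrD addrK.
set Z := \sum_(j < t.+1) x ^+ j.
have Z0 : 0 < Z by exact: geom_norm_gt0.
have hx1 : 0 < 1 - x by rewrite x1 divr_gt0// ltr0n.
have hZ : (1 - x) <= Z^-1.
  rewrite -[Z^-1]mul1r ler_pdivlMr// -[leLHS]opprK -mulNr opprB -subrX1 opprB.
  by rewrite gerBl exprn_ge0.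
(* All configurations of [t] pebbles have the same weight, so only the total mass of [configs G t]
   has to be bounded below. *)
rewrite (eq_bigr (fun=> x ^+ t / Z ^+ N)); last first.
  move=> D /hE; rewrite inE => /eqP hD; rewrite big_split /= prodr_const.
  by rewrite -exprVn -[in x ^+ t]hD expr_sum.
rewrite sumr_const -[X in _ <= _ * X]mulr_natl mulrCA ler_wpM2l ?ler0n//.
have cC : #|configs G t| = 'C(u + t, t) by rewrite card_ffun_sum_eq// ltnW.
have C0 : 0 < #|configs G t|%:R :> R by rewrite cC ltr0n bin_gt0 leq_addl.
rewrite -[leLHS]mul1r ler_pdivrMr//.
have hm : n%:R ^+ n <= (N + t)%:R * (#|configs G t|%:R * t%:R ^+ t * u%:R ^+ u) :> R.
  rewrite -!natrX -!natrM ler_nat cC; have := expn_self_le t u.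
  by rewrite [(t + u)%N]addnC -/n (_ : n.+1 = (N + t)%N)//; rewrite /n /u; lia.
(* One factor [N + t] comes from the number of binomial terms; [h2] spends the other on the passage
   from [(1 - x) ^+ u] to [(1 - x) ^+ N]. *)
have h1 : 1 <= (N + t)%:R * #|configs G t|%:R * (x ^+ t * (1 - x) ^+ u).
  rewrite x1 /x !expr_div_n mulf_div -exprD [(t + u)%N]addnC -/n mulrA.
  by rewrite ler_pdivlMr ?exprn_gt0// mul1r (le_trans hm)// !mulrA.
have h2 : 1 <= (N + t)%:R * (1 - x).
  rewrite x1 mulrA ler_pdivlMr// mul1r -natrM ler_nat /n.
  by rewrite (leq_trans _ (leq_pmulr _ u0))// /u; lia.
apply: le_trans (_ : (N + t)%:R ^+ 2 * (x ^+ t * (1 - x) ^+ N) * #|configs G t|%:R <= _).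
  rewrite [leRHS](_ : _ = ((N + t)%:R * #|configs G t|%:R * (x ^+ t * (1 - x) ^+ u))
     * ((N + t)%:R * (1 - x))); first exact: mulr_ege1.
  by rewrite (_ : N = u.+1) ?exprS; [ring|rewrite /u; lia].
rewrite ler_pM2r// ler_wpM2l ?sqr_ge0// ler_wpM2l ?exprn_ge0//.
rewrite -exprVn; apply: lerXn2r => //; rewrite nnegrE ltW//.
by rewrite invr_gt0.
Qed.

(** A solvable configuration has a vertex with at least [m] pebbles, or in every block [B j] some
    [v] with at least [K v]. The first event is handled by a union bound on tails, the second by
    independence of the blocks. *)
Lemma prob_solvable_le (R : realType) (G : sgraph) (t : nat) (J : finType)
    (B : J -> {set G}) (K : G -> nat) (m : nat)
    (x := t%:R / (#|G|.-1 + t)%:R : R) :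
  (1 < #|G|)%N ->
  (forall j k v, v \in B j -> v \in B k -> j = k) ->
  (forall (D : config G) j, (forall v, D v < m)%N ->
    (forall v, v \in B j -> D v < K v)%N -> ~ solvable D) ->
  prob_solvable G R t <= (#|G| + t)%:R ^+ 2 *
    (#|G|%:R * x ^+ m + \prod_j (1 - \prod_(v in B j) (1 - x ^+ K v))).
Proof.
move=> hN hB hS.
have x0 : 0 <= x by rewrite divr_ge0.
have x1 : x <= 1.
  by rewrite ler_pdivrMr ?mul1r ?ler_nat ?ltr0n ?leq_addl//; lia.
apply: le_trans (card_configs_ratio_le R hN _) _.
  by apply/fintype.subsetP => D; rewrite inE => /andP[].
rewrite -/x ler_wpM2l ?sqr_ge0//.
pose w (D : {ffun G -> 'I_t.+1}) : R := \prod_v geom x (D v).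
have w0 D : 0 <= w D by apply: prodr_ge0 => v _; exact: geom_ge0.
(* A sum of indicators that dominates the indicator of solvability. *)
pose e (D : {ffun G -> 'I_t.+1}) : R := \sum_v (m <= D v)%:R
  + \prod_j (1 - \prod_(v in B j) (D v < K v)%:R).
have p01 (A : {set G}) (D : {ffun G -> 'I_t.+1}) :
    \prod_(v in A) (D v < K v)%:R = [forall v in A, (D v < K v)%N]%:R :> R.
  case: (boolP [forall v in A, _]) => [/forall_inP h|].
    by rewrite big1// => v /h ->.
  rewrite negb_forall => /existsP[v]; rewrite negb_imply => /andP[vA h].
  by rewrite (bigD1 v)//= (negbTE h) mul0r.
have e0 D : 0 <= e D.
  rewrite addr_ge0 ?sumr_ge0// prodr_ge0// => j _; rewrite p01.
  by case: [forall _ in _, _]; rewrite ?subrr ?subr0.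
have e1 D : D \in [set D in configs G t | `[< solvable (to_config D) >]]%SET -> 1 <= e D.
  rewrite !inE => /andP[_ /asboolP hD]; case: (boolP [exists v, m <= D v]%N).
    move=> /existsP[v hv]; rewrite /e (bigD1 v)//= hv -addrA lerDl addr_ge0//.
      by apply: sumr_ge0 => *; rewrite ler0n.
    rewrite prodr_ge0// => j _; rewrite p01.
    by case: [forall _ in _, _]; rewrite ?subrr ?subr0.
  rewrite negb_exists => /forallP hm; rewrite /e [X in _ + X]big1 ?lerDr ?sumr_ge0//.
  move=> j _; rewrite p01; case: (boolP [forall v in B j, _]); last by rewrite subr0.
  move=> /forall_inP hj; case: (hS (to_config D) j) => // [v|v vj].
    by rewrite ffunE ltnNge.
  by rewrite ffunE hj.
apply: le_trans (_ : \sum_D w D * e D <= _).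
  rewrite big_mkcond; apply: ler_sum => D _; case: ifP => [/e1 h|_].
    exact: ler_peMr (w0 D) h.
  exact: mulr_ge0 (w0 D) (e0 D).
have -> : \sum_D w D * e D = \sum_D w D * (\sum_v (m <= D v)%:R)
    + \sum_D w D * \prod_j (1 - \prod_(v in B j) (D v < K v)%:R).
  by rewrite -big_split /=; apply: eq_bigr => D _; rewrite -mulrDr.
rewrite lerD//.
  rewrite (eq_bigr (fun D => \sum_v w D * (m <= D v)%:R)) => [|D _]; last exact: mulr_sumr.
  rewrite exchange_big /= mulr_natl -sumr_const; apply: ler_sum => v _.
  rewrite [leLHS](_ : _ = \sum_(i < t.+1) geom x i * (m <= i)%:R); first exact: geom_tail.
  apply: (@sum_prod_one_coord R G _ (fun=> @geom R t x) (fun i => (m <= i)%:R)).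
  by move=> u; exact: sum_geom.
have -> : \sum_D w D * \prod_j (1 - \prod_(v in B j) (D v < K v)%:R)
    = \prod_j (1 - \prod_(v in B j) \sum_(i < t.+1) geom x i * (i < K v)%:R).
  apply: (@sum_prod_disjoint_blocks R G _ J B (fun=> @geom R t x)
    (fun v i => (i < K v)%:R)) => // v; exact: sum_geom.
apply: ler_prod => j _; apply/andP; split.
  rewrite subr_ge0 prodr_ile1// => v _; apply/andP; split.
    by apply: sumr_ge0 => i _; rewrite mulr_ge0// geom_ge0.
  rewrite -[leRHS](sum_geom t x0); apply: ler_sum => i _.
  by rewrite ler_piMr ?geom_ge0// lern1 leq_b1.
rewrite lerD2l lerN2; apply: ler_prod => v _; rewrite geom_head// andbT.
by rewrite subr_ge0 exprn_ile1.
Qed.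

(** * Sums over distances to a fixed vertex *)

Definition absdiff (x y : nat) : nat := ((x - y) + (y - x))%N.

(** The points up to [r] and those from [r] on are summed separately; [r] itself occurs twice,
    whence the extra [f 0]. *)
Lemma sum_absdiff (V : nmodType) (f : nat -> V) (n r : nat) : (r < n)%N ->
  \sum_(k < n) f (absdiff k r) + f 0%N = \sum_(i < r.+1) f i + \sum_(i < n - r) f i.
Proof.
move=> rn; rewrite -(big_mkord xpredT (fun k => f (absdiff k r))).
rewrite (@big_cat_nat _ _ _ r.+1)//= -addrA; congr (_ + _).
  rewrite big_nat_rev -(big_mkord xpredT f) big_nat_cond [RHS]big_nat_cond.
  by apply: eq_bigr => i /andP[/andP[_ hi] _]; congr f; rewrite /absdiff; lia.
rewrite (_ : n - r = (n - r.+1).+1)%N; last by lia.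
rewrite big_ord_recl addrC; congr (_ + _).
rewrite -{1}[r.+1]add0n big_addn big_mkord.
by apply: eq_bigr => i _; congr f; rewrite /absdiff /= /bump; lia.
Qed.

Lemma sum_ffun_recl (V : nmodType) (I : finType) d (F : {ffun 'I_d.+1 -> I} -> V) :
  \sum_f F f = \sum_(k : I) \sum_(g : {ffun 'I_d -> I})
    F [ffun i => if unlift ord0 i is Some j then g j else k].
Proof.
rewrite pair_big /= (reindex (fun p : I * {ffun 'I_d -> I} =>
  [ffun i => if unlift ord0 i is Some j then p.2 j else p.1])) //=.
apply: onW_bij; exists (fun f : {ffun 'I_d.+1 -> I} => (f ord0, [ffun j => f (lift ord0 j)])).
  move=> [k g] /=; rewrite ffunE unlift_none; congr (_, _); apply/ffunP => j.
  by rewrite !ffunE liftK.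
move=> f; apply/ffunP => i; rewrite ffunE.
by case: unliftP => [j|] -> //=; rewrite ffunE.
Qed.

Lemma sum_subn_double (l s : nat) :
  ((\sum_(i < s) (l - i)).*2 <= l * l.+1)%N.
Proof.
suff : ((\sum_(i < s) (l - i)).*2 + (l - s) * (l - s).+1 = l * l.+1)%N.
  by move=> <-; rewrite leq_addr.
elim: s => [|s IH]; first by rewrite big_ord0 subn0.
rewrite big_ord_recr /= -IH; case: (leqP l s) => h.
  have -> : (l - s = 0)%N by lia.
  have -> : (l - s.+1 = 0)%N by lia.
  by rewrite addn0.
have [e he] : exists e, (l - s = e.+1)%N by exists (l - s).-1; lia.
have -> : (l - s.+1 = e)%N by lia.
rewrite he; move: (\sum_(i < s) _)%N => S; rewrite -!mul2n; nia.
Qed.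

(** As [(l - i) ^ p.+1 <= l ^ p * (l - i)], each side of [r] gives at most [l ^ p.+1 * l.+1 / 2].
    Removing the doubly counted [l ^ p.+1] leaves constant exactly 1. *)
Lemma sum_pow_subn_absdiff (l r n p : nat) : (r < n)%N ->
  (\sum_(k < n) (l - absdiff k r) ^ p.+1 <= l ^ p.+2)%N.
Proof.
move=> rn; pose f i := ((l - i) ^ p.+1)%N.
have h s : ((\sum_(i < s) f i).*2 <= l ^ p * (l * l.+1))%N.
  apply: leq_trans (_ : l ^ p * (\sum_(i < s) (l - i)).*2 <= _)%N; last first.
    by rewrite leq_mul2l sum_subn_double orbT.
  rewrite -doubleMr leq_double big_distrr /=; apply: leq_sum => i _.
  rewrite /f expnSr leq_mul2r; apply/orP; right.
  by case: (p) => // p'; rewrite leq_exp2r// leq_subr.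
have e : (\sum_(k < n) f (absdiff k r) + f 0
  = \sum_(i < r.+1) f i + \sum_(i < n - r) f i)%N := sum_absdiff f rn.
have f0 : (f 0 = l ^ p * l)%N by rewrite /f subn0 expnSr.
have := h r.+1; have := h (n - r)%N; move: e; rewrite f0 !expnS.
move: (\sum_(i < n - r) _)%N (\sum_(i < r.+1) _)%N (\sum_(i < n) _)%N (l ^ p)%N.
move=> S1 S2 S L; rewrite -!mul2n; nia.
Qed.

(** Summing out one coordinate at a time raises the exponent by one. This sum is the exponent of 2
    in the probability of a sparse block. *)
Lemma sum_subn_l1_le (l n r d : nat) : (r < n)%N ->
  (\sum_(g : {ffun 'I_d.+1 -> 'I_n}) (l - \sum_i absdiff (g i) r) <= l ^ d.+2)%N.
Proof.
move=> rn; elim: d l => [|d IH] l.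
  apply: leq_trans (@sum_pow_subn_absdiff l r n 0 rn).
  rewrite (sum_ffun_recl (fun g : {ffun 'I_1 -> 'I_n} => l - \sum_i absdiff (g i) r)%N).
  apply: leq_sum => k _.
  rewrite (eq_bigr (fun=> l - absdiff k r)%N) => [|g _].
    by rewrite sum_nat_const card_ffun !card_ord expn0 mul1n expn1.
  by rewrite big_ord1 ffunE unlift_none.
apply: leq_trans (@sum_pow_subn_absdiff l r n d.+1 rn).
rewrite (sum_ffun_recl (fun g : {ffun 'I_d.+2 -> 'I_n} => l - \sum_i absdiff (g i) r)%N).
apply: leq_sum => k _; apply: leq_trans (IH _); apply: leq_sum => g _.
rewrite /= [in leqLHS]big_ord_recl ffunE unlift_none subnDA.
rewrite (eq_bigr (fun i => absdiff (g i) r)) => [//|i _].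
by rewrite ffunE liftK.
Qed.

Lemma sum_expr_le (R : realFieldType) (y : R) (n : nat) : 0 <= y -> y < 1 ->
  \sum_(i < n) y ^+ i <= (1 - y)^-1.
Proof.
move=> y0 y1; have h : 0 < 1 - y by rewrite subr_gt0.
rewrite -[leRHS]mul1r ler_pdivlMr// mulrC -[leLHS]opprK -mulNr opprB -subrX1 opprB.
by rewrite gerBl exprn_ge0.
Qed.

Lemma sum_expr_absdiff_le (R : realFieldType) (y : R) (n r : nat) :
  0 <= y -> y < 1 -> (r < n)%N ->
  \sum_(k < n) y ^+ absdiff k r <= 2 / (1 - y).
Proof.
move=> y0 y1 rn; have := sum_absdiff (fun k => y ^+ k) rn.
have := sum_expr_le r.+1 y0 y1; have := sum_expr_le (n - r) y0 y1.
rewrite expr0 mulr_natl mulr2n; move: (\sum_(k < n) _) => S.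
move: (\sum_(_ < _) _) (\sum_(_ < _) _) => S1 S2; lra.
Qed.

Lemma sum_expr_l1dist_le (R : realFieldType) (y : R) d n (r : {ffun 'I_d -> 'I_n}) :
  0 <= y -> y < 1 ->
  \sum_(v : {ffun 'I_d -> 'I_n}) y ^+ l1dist v r <= (2 / (1 - y)) ^+ d.
Proof.
move=> y0 y1; rewrite -[d in leRHS]card_ord -prodr_const.
rewrite (eq_bigr (fun v : {ffun 'I_d -> 'I_n} => \prod_i y ^+ absdiff (v i) (r i))) => [|v _];
  last by rewrite /l1dist expr_sum.
rewrite -(bigA_distr_bigA (fun i (k : 'I_n) => y ^+ absdiff k (r i))).
apply: ler_prod => i _; rewrite sum_expr_absdiff_le// andbT.
by apply: sumr_ge0 => k _; apply: exprn_ge0.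
Qed.

(* Outside [B], [2^-1 ^+ k <= 2^-1 ^+ a * (2 / 3) ^+ k] for [k > 3 * a], because
   [(3 / 4) ^+ 3 <= 1 / 2]. *)
Lemma not_solvable_at_of_block (R : realFieldType) d n (r : grid d n) (B : {set grid d n})
    (a m : nat) (D : config (grid d n)) :
  (forall v, v \notin B -> 3 * a < l1dist v r)%N ->
  (forall v, v \in B -> D v * (2 * #|B|) <= 2 ^ l1dist v r)%N ->
  (forall v, D v < m)%N -> (2 * (m * 6 ^ d) < 2 ^ a)%N ->
  ~ solvable_at r D.
Proof.
move=> hout hin hm ha /(@solvable_at_pweight R _ (fun v : grid d n => @l1dist d n v r)).
move=> /(_ (fun u v => @l1dist_adj d n u v r) (l1distxx r)); apply/negP; rewrite -ltNge.
rewrite /pweight (bigID (fun v => v \in B)) /=.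
(* The block contributes at most 1/2, namely [1 / (2 * #|B|)] per vertex. The factor [6 ^ d] is the
   bound of [sum_expr_l1dist_le] at [y = 2 / 3]. *)
apply: (@le_lt_trans _ _ (2^-1 + (m * 6 ^ d)%:R / 2 ^+ a)); last first.
  have : 0 < (2 ^+ a : R) by rewrite exprn_gt0.
  have : 2 * (m * 6 ^ d)%:R < (2 ^+ a : R) by rewrite -natrX -natrM ltr_nat.
  move: (2 ^+ a) ((m * 6 ^ d)%:R) => A M hM A0.
  have : M / A < 2^-1 by rewrite ltr_pdivrMr//; lra.
  lra.
apply: lerD.
  case: (posnP #|B|) => [/card0_eq B0|B0]; first by rewrite big_pred0.
  apply: (@le_trans _ _ (\sum_(v in B) (2 * #|B|%:R)^-1)).
    apply: ler_sum => v vB; rewrite exprVn ler_pdivrMr ?exprn_gt0// mulrC.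
    rewrite ler_pdivlMr ?mulr_gt0 ?ltr0n//.
    by rewrite -natrM -natrM -natrX ler_nat hin.
  rewrite sumr_const invfM -[X in X <= _]mulr_natr -mulrA mulVf ?mulr1 ?lexx//.
  by rewrite pnatr_eq0 -lt0n.
apply: (@le_trans _ _ (\sum_(v : grid d n) m%:R / 2 ^+ a * (2 / 3) ^+ @l1dist d n v r)).
  rewrite [leLHS]big_mkcond; apply: ler_sum => v _.
  have h0 : 0 <= (2 / 3 : R) ^+ @l1dist d n v r by apply: exprn_ge0.
  case: ifP => [/hout hv|_]; last by rewrite mulr_ge0// divr_ge0// exprn_ge0.
  rewrite -mulrA ler_pM ?ler0n ?exprn_ge0 ?ler_nat ?(ltnW (hm v))//.
  have -> : 2^-1 = 3 / 4 * (2 / 3) :> R by field.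
  rewrite exprMn ler_wpM2r//.
  apply: (@le_trans _ _ ((3 / 4) ^+ (3 * a))).
    by apply: ler_wiXn2l; [lra|lra|exact: ltnW].
  have h : (3 / 4) ^+ 3 <= 2^-1 :> R by rewrite !exprS expr0; lra.
  rewrite exprM -exprVn; apply: lerXn2r => //; rewrite nnegrE ?exprn_ge0//; lra.
rewrite -mulr_sumr natrM mulrAC ler_wpM2r ?invr_ge0 ?exprn_ge0//.
rewrite ler_wpM2l ?ler0n// natrX.
have -> : 6 = 2 / (1 - 2 / 3) :> R by field.
by apply: sum_expr_l1dist_le; lra.
Qed.

(** * Lower bound: the probability of sparse blocks *)

(** A Bernoulli inequality, written without division. *)
Lemma expr_mul_le1 (R : realFieldType) (x : R) (k : nat) : 0 <= x -> x <= 1 ->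
  x ^+ k * (1 + k%:R * (1 - x)) <= 1.
Proof.
move=> x0 x1; elim: k => [|k IH]; first by rewrite expr0 mul0r addr0 mulr1.
have h0 : 0 <= x ^+ k by apply: exprn_ge0.
have h1 : x ^+ k <= 1 by apply: exprn_ile1.
rewrite exprS -natr1; move: (x ^+ k) (k%:R) IH h0 h1 => z c IH h0 h1.
have : x * (z * (1 + c * (1 - x))) <= x * 1 by apply: ler_wpM2l.
have : x * z * (1 - x) <= 1 * (1 - x) by apply: ler_wpM2r; [lra|rewrite mulr_ile1].
nra.
Qed.

Lemma expr_mul_exp2_le (R : realFieldType) (x : R) (k M : nat) : 0 <= x -> x <= 1 ->
  1 <= k%:R * (1 - x) -> x ^+ (k * M) <= 2^-1 ^+ M.
Proof.
move=> x0 x1 hk; rewrite exprM lerXn2r ?nnegrE ?exprn_ge0//.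
have := expr_mul_le1 k x0 x1; have : 0 <= x ^+ k by apply: exprn_ge0.
move: (x ^+ k) (k%:R * _) hk => z y *; nra.
Qed.

(** With [k] the exponent of [x] and [W = 8 * b * 2 ^ (l - e)], one has [k * (1 - x) >= 1 / W], so
    Bernoulli gives [1 - x ^+ k >= 1 / (W + 1) >= 1 / (2 * W)]. Beyond distance [l] the truncated
    [l - e] is 0. *)
Lemma geom_factor_ge (R : realFieldType) (x : R) (b l e : nat) :
  0 <= x -> x <= 1 -> (0 < b)%N -> 1 <= 2 ^+ (l + 2) * (1 - x) ->
  (16 * b * 2 ^ (l - e))%:R^-1 <= 1 - x ^+ (2 ^ e %/ (2 * b)).+1.
Proof.
move=> x0 x1 b0 hx; set k := (_ %/ _).+1.
have hk : (2 ^ (l + 2) <= k * (8 * b * 2 ^ (l - e)))%N.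
  have h1 : (2 ^ e <= k * (2 * b))%N by rewrite ltnW// ltn_ceil// muln_gt0 b0.
  apply: leq_trans (_ : 4 * (2 ^ e * 2 ^ (l - e)) <= _)%N.
    rewrite -expnD addnC expnD leq_mul2l/= leq_exp2l//; lia.
  have -> : (k * (8 * b * 2 ^ (l - e)) = 4 * (k * (2 * b) * 2 ^ (l - e)))%N by ring.
  by rewrite leq_mul2l/= leq_mul2r h1 orbT.
set W := (8 * b * 2 ^ (l - e))%N in hk.
have -> : (16 * b * 2 ^ (l - e) = 2 * W)%N by rewrite /W; ring.
have W1 : 1 <= W%:R :> R by rewrite ler1n /W !muln_gt0 b0 expn_gt0.
have hy : 1 <= k%:R * W%:R * (1 - x).
  rewrite (le_trans hx)// ler_wpM2r ?subr_ge0//.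
  by rewrite -natrM -natrX ler_nat.
have W0 : 0 < (2 * W)%:R :> R by rewrite natrM mulr_gt0//; lra.
rewrite -[leLHS]mul1r ler_pdivrMr// natrM.
move: (expr_mul_le1 k x0 x1) (exprn_ge0 k x0) (exprn_ile1 k x0 x1).
move: (x ^+ k) (W%:R) (k%:R) hy W1 => z w c hy w1 h h0 h1.
have e1 : z * (1 + c * (1 - x)) * w <= 1 * w by apply: ler_wpM2r => //; lra.
have e2 : z * 1 <= z * (c * w * (1 - x)) by apply: ler_wpM2l.
have e3 : 0 <= (w - 1) * (1 - z) by apply: mulr_ge0; lra.
have e4 : z * (1 + c * (1 - x)) * w = z * w + z * (c * w * (1 - x)) by ring.
nra.
Qed.

Lemma absdiff_center (a w k : nat) (s := (6 * a + 1)%N) :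
  (w %/ s)%N != k -> (3 * a < absdiff w (s * k + 3 * a))%N.
Proof.
have s0 : (0 < s)%N by rewrite /s addn1.
have := ltn_pmod w s0; have := divn_eq w s.
move: (w %/ s)%N (w %% s)%N => Q T -> hT /eqP hi; rewrite /absdiff.
have [h|h|//] := ltngtP Q k.
  have : (Q.+1 * s <= s * k)%N by rewrite mulnC leq_mul2l h orbT.
  rewrite mulSn; move: (Q * s)%N (s * k)%N => A B; lia.
have : (s * k.+1 <= Q * s)%N by rewrite [leqRHS]mulnC leq_mul2l h orbT.
rewrite mulnS; move: (Q * s)%N (s * k)%N => A B; rewrite /s; lia.
Qed.

(** A block is sparse with probability at least [1 / P], and there are at least [P * M] blocks, so
    all of them fail to be sparse with probability at most [2^-1 ^+ M]. The same bound holds for one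
    vertex having [2 ^ (l + 2) * M] pebbles. *)
Lemma prob_solvable_grid_le (R : realType) d n a l M t (s := (6 * a + 1)%N) :
  (0 < d)%N -> (1 < n ^ d)%N -> (t <= n ^ d * 2 ^ l)%N ->
  (2 * (2 ^ (l + 2) * M * 6 ^ d) < 2 ^ a)%N ->
  ((16 * s ^ d) ^ (s ^ d) * 2 ^ (l ^ d.+1) * M <= (n %/ s) ^ d)%N ->
  prob_solvable (grid d n) R t
    <= (n ^ d + t)%:R ^+ 2 * ((n ^ d).+1%:R * 2^-1 ^+ M).
Proof.
move=> d0 hN ht ha hM; set q := (n %/ s)%N in hM.
have s0 : (0 < s)%N by rewrite /s addn1.
have blkP (j : 'I_q) (g : 'I_s) : (s * j + g < n)%N.
  apply: leq_trans (leq_divM n s); rewrite -/q.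
  apply: (@leq_trans (s * j.+1)); first by rewrite mulnS addnC ltn_add2r.
  by rewrite [leqRHS]mulnC leq_mul2l ltn_ord orbT.
pose blk (j : {ffun 'I_d -> 'I_q}) (g : {ffun 'I_d -> 'I_s}) : grid d n :=
  [ffun i => Ordinal (blkP (j i) (g i))].
have blkE j g i : blk j g i = (s * j i + g i)%N :> nat by rewrite ffunE.
have blk_div j g i : (blk j g i %/ s)%N = j i.
  by rewrite blkE mulnC divnMDl// divn_small ?addn0.
have blk_mod j g i : (blk j g i %% s)%N = g i.
  by rewrite blkE mulnC modnMDl modn_small.
have blk_inj j : injective (blk j).
  by move=> g h e; apply/ffunP => i; apply: val_inj; rewrite /= -!(blk_mod j) e.
pose B j : {set grid d n} := (blk j @: [set: {ffun 'I_d -> 'I_s}])%SET.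
have cB j : #|B j| = (s ^ d)%N by rewrite card_imset// cardsT card_ffun !card_ord.
have midP : (3 * a < s)%N by rewrite /s; lia.
pose r j : grid d n := blk j [ffun=> Ordinal midP].
(* Reading residues modulo [s] gives the distance to the centre of the block of [v] without
   reference to the block. *)
pose e (v : grid d n) := (\sum_i absdiff (v i %% s) (3 * a))%N.
have eE j g : e (blk j g) = (\sum_i absdiff (g i) (3 * a))%N.
  by apply: eq_bigr => i _; rewrite blk_mod.
have dE j v : v \in B j -> l1dist v (r j) = e v.
  move=> /imsetP[g _ ->]; rewrite eE; apply: eq_bigr => i _.
  by rewrite !blkE ffunE /= /absdiff !subnDl.
(* Fewer than [K v] pebbles means at most [2 ^ e v / (2 * s ^ d)], the per-vertex allowance of
   [not_solvable_at_of_block]. *)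
pose K v := (2 ^ e v %/ (2 * s ^ d)).+1.
pose x : R := t%:R / (#|grid d n|.-1 + t)%:R.
have cN : #|grid d n| = (n ^ d)%N := card_grid d n.
have p0 : 0 < ((n ^ d).-1 + t)%:R :> R by rewrite ltr0n; lia.
have x0 : 0 <= x by rewrite divr_ge0.
have x1 : x <= 1 by rewrite /x cN ler_pdivrMr// mul1r ler_nat leq_addl.
have hx : 1 <= 2 ^+ (l + 2) * (1 - x).
  have -> : 1 - x = (n ^ d).-1%:R / ((n ^ d).-1 + t)%:R.
    by rewrite /x cN -[X in X - _](divff (lt0r_neq0 p0)) -mulrBl natrD addrK.
  rewrite mulrA ler_pdivlMr// mul1r -natrX -natrM ler_nat expnD.
  have : (0 < 2 ^ l)%N by rewrite expn_gt0.
  move: ht hN; move: (n ^ d)%N (2 ^ l)%N => N L; nia.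
have q0 : (0 < (16 * s ^ d) ^ (s ^ d) * 2 ^ (l ^ d.+1))%N.
  by rewrite muln_gt0 !expn_gt0 muln_gt0 expn_gt0 s0.
set P := ((16 * s ^ d) ^ (s ^ d) * 2 ^ (l ^ d.+1))%N in hM q0.
have P0 : 0 < P%:R :> R by rewrite ltr0n.
have hP j : P%:R^-1 <= \prod_(v in B j) (1 - x ^+ K v).
  apply: (@le_trans _ _ (\prod_(v in B j) (16 * s ^ d * 2 ^ (l - e v))%:R^-1)).
    rewrite big_imset /=; last by move=> ? ? _ _; exact: blk_inj.
    rewrite (eq_bigr (fun g : {ffun 'I_d -> 'I_s} => ((16 * s ^ d)%:R : R)^-1
      * 2^-1 ^+ (l - \sum_i absdiff (g i) (3 * a)))) => [|g _]; last first.
      by rewrite eE natrM natrX invfM exprVn.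
    rewrite big_split /= prodr_const cardsT card_ffun !card_ord -expr_sum.
    rewrite /P natrM invfM natrX exprVn ler_wpM2l ?invr_ge0 ?exprn_ge0 ?ler0n//.
    rewrite natrX -exprVn ler_wiXn2l ?invr_ge0 ?invf_le1 ?ler1n//.
    rewrite -(prednK d0); apply: leq_trans (sum_subn_l1_le l d.-1 midP).
    by rewrite prednK// leq_eqVlt; apply/orP; left; apply/eqP/eq_bigl => g; rewrite inE.
  apply: ler_prod => v _; rewrite invr_ge0 ler0n /=.
  by apply: geom_factor_ge; rewrite // expn_gt0 s0.
apply: le_trans (@prob_solvable_le R (grid d n) t _ B K (2 ^ (l + 2) * M) _ _ _) _.
- by rewrite cN.
- move=> j k v /imsetP[g _ ->] /imsetP[h _ ebk]; apply/ffunP => i; apply: val_inj.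
  by rewrite /= -(blk_div j g) ebk blk_div.
- move=> D j hm hB /(_ (r j)).
  apply: (@not_solvable_at_of_block R d n (r j) (B j) a (2 ^ (l + 2) * M)) => //.
  + move=> v vB; have [i hi] : exists i, (v i %/ s)%N != j i.
      apply/existsP; rewrite -negb_forall; apply: contra vB => /forallP h.
      apply/imsetP; exists [ffun i => Ordinal (ltn_pmod (v i) s0)] => //.
      apply/ffunP => i; apply: val_inj; rewrite /= blkE ffunE /= -(eqP (h i)).
      by rewrite mulnC -divn_eq.
    rewrite /l1dist (bigD1 i)//= ltn_addr// blkE ffunE /=.
    exact: absdiff_center hi.
  + move=> v vB; rewrite cB dE//; have := hB v vB; rewrite /K ltnS.
    rewrite leq_divRL// ?muln_gt0 ?expn_gt0 ?s0//.
rewrite -/x cN ler_wpM2l ?sqr_ge0// -natr1 mulrDl mul1r lerD//.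
  rewrite ler_wpM2l ?ler0n// expr_mul_exp2_le//.
  by rewrite natrX.
apply: (@le_trans _ _ (\prod_(j : {ffun 'I_d -> 'I_q}) (1 - P%:R^-1))).
  apply: ler_prod => j _; rewrite lerD2l lerN2 hP andbT subr_ge0.
  by apply: prodr_ile1 => v _; rewrite subr_ge0 exprn_ile1//= gerBl exprn_ge0.
rewrite prodr_const card_ffun !card_ord.
have Pi : P%:R^-1 <= 1 :> R by rewrite invf_le1// ler1n.
apply: (@le_trans _ _ ((1 - P%:R^-1) ^+ (P * M))).
  by rewrite ler_wiXn2l// ?subr_ge0// gerBl invr_ge0.
apply: expr_mul_exp2_le; rewrite ?subr_ge0 ?gerBl ?invr_ge0//.
by rewrite opprB addrC subrK divff// gt_eqF.
Qed.

(** * Lower bound: choice of parameters *)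

(** With [q = m %/ D.+1], one factor [2 ^ q] absorbs the constant [X] and the other [D] absorb the
    power, since [m.+1 <= D.+1 * 2 ^ q]. *)
Lemma poly_le_exp2 (A D : nat) :
  exists m0, forall m, (m0 <= m)%N -> (A * m.+1 ^ D <= 2 ^ m)%N.
Proof.
set X := (A * D.+1 ^ D)%N; exists (X * D.+1)%N => m hm.
have hX : (X <= 2 ^ (m %/ D.+1))%N.
  apply: leq_trans (ltnW (ltn_expl X (ltnSn 1))) _.
  by rewrite leq_exp2l// leq_divRL.
have h1 : (m.+1 <= D.+1 * 2 ^ (m %/ D.+1))%N.
  apply: (@leq_trans (D.+1 * (m %/ D.+1).+1)); first by rewrite mulnC ltn_ceil.
  by rewrite leq_mul2l/= ltn_expl.
apply: (@leq_trans (A * (D.+1 * 2 ^ (m %/ D.+1)) ^ D)).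
  by case: (D) h1 => [|D'] h1; rewrite ?expn0// leq_mul2l leq_exp2r// h1 orbT.
rewrite expnMn mulnA -/X -expnM.
apply: leq_trans (leq_mul hX (leqnn _)) _.
rewrite -expnD leq_exp2l// -mulnS mulnC -[leqRHS]muln1.
by rewrite muln1 mulnC leq_divM.
Qed.

Lemma poly_le_exp2_div (A D C : nat) : (0 < C)%N ->
  exists K0, forall K, (K0 <= K)%N -> (A * K.+1 ^ D <= 2 ^ (K %/ C))%N.
Proof.
move=> C0; have [m0 h] := poly_le_exp2 (A * C ^ D) D.
exists (m0 * C)%N => K hK; apply: leq_trans (h _ _); last by rewrite leq_divRL.
rewrite -mulnA -expnMn leq_mul2l; apply/orP; right.
case: D {h} => // D; rewrite leq_exp2r// mulnC; exact: ltn_ceil.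
Qed.

(** Here [K] plays the role of the integer part of [L] and [1 / h] that of [eps]. The previous bound
    is applied with [a = 2 * K]; [2 ^ e] dominates every factor polynomial in [K]. *)
Lemma prob_solvable_grid_le_half (R : realType) (d h : nat) : (0 < d)%N -> (0 < h)%N ->
  exists K0, forall K n l t, (K0 <= K)%N ->
    (2 ^ K ^ d.+1 <= n ^ d)%N -> (n ^ d <= 2 ^ K.+1 ^ d.+1)%N ->
    (l * h + K <= K * h)%N -> (t <= n ^ d * 2 ^ l)%N ->
    prob_solvable (grid d n) R t <= 2^-1.
Proof.
move=> d0 h0; set C := (3 * 13 ^ d * h)%N.
have C0 : (0 < C)%N by rewrite !muln_gt0 expn_gt0.
have [K0 hK0] := poly_le_exp2_div (100 * 26 ^ d) d.+1 C0.
exists (maxn K0 2) => K n l t; rewrite geq_max => /andP[/hK0 hexp K2] hn1 hn2 hl ht.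
set e := (K %/ C)%N in hexp.
have lK : (l < K)%N by nia.
have hS : (K.+1 ^ d.+1 > 0)%N by rewrite expn_gt0.
have h26 : (26 ^ d > 0)%N by rewrite expn_gt0.
(* The prefactor is at most [(n ^ d) ^ 8], which [2 ^ (8 * K.+1 ^ d.+1)] bounds; the extra unit
   leaves the final 1/2. *)
set M := (8 * K.+1 ^ d.+1).+1.
have hM : (M <= 2 ^ e)%N.
  apply: leq_trans hexp; rewrite /M; move: (K.+1 ^ d.+1)%N (26 ^ d)%N hS h26 => x y; nia.
set s := (6 * (2 * K) + 1)%N.
have s13 : (s <= 13 * K)%N by rewrite /s; lia.
have hpow x y : (x <= y)%N -> (x ^ d <= y ^ d)%N by move=> xy; rewrite leq_exp2r.
have KS : (K ^ d <= K.+1 ^ d.+1)%N.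
  by rewrite (leq_trans (hpow _ _ (leqnSn K)))// leq_pexp2l.
have hs : ((2 * s) ^ d <= 2 ^ e)%N.
  apply: leq_trans hexp; apply: (@leq_trans (26 ^ d * K ^ d)).
    by rewrite -expnMn hpow//; lia.
  rewrite -mulnA [leqRHS]mulnCA leq_mul2l; apply/orP; right.
  by rewrite (leq_trans KS)// leq_pmull.
have hb : (16 * s ^ d <= 2 ^ e)%N.
  apply: leq_trans hexp; apply: (@leq_trans (16 * (26 ^ d * K ^ d))).
    by rewrite leq_mul2l/= -expnMn hpow//; lia.
  rewrite -mulnA; apply: leq_mul => //; exact: leq_mul.
have eK : (e * C <= K)%N by exact: leq_divM.
have Kd0 : (0 < K ^ d)%N by rewrite expn_gt0; lia.
have sb : (s ^ d + 2 <= 3 * 13 ^ d * K ^ d)%N.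
  have : (s ^ d <= 13 ^ d * K ^ d)%N by rewrite -expnMn hpow.
  have : (0 < 13 ^ d * K ^ d)%N by rewrite muln_gt0 expn_gt0.
  rewrite -mulnA; lia.
(* The gap [K ^ d.+1 - l ^ d.+1] is at least [K ^ d.+1 / h], and [C] is chosen so that this pays for
   [s ^ d + 2] factors [2 ^ e]: [s ^ d] for the block, one for [M], one for replacing [n %/ s] by
   [n / (2 * s)]. *)
have hexpo : (e * (s ^ d + 2) + l ^ d.+1 <= K ^ d.+1)%N.
  rewrite -(leq_pmul2r h0) mulnDl.
  have h1 : (l ^ d.+1 * h + K ^ d.+1 <= K ^ d.+1 * h)%N.
    rewrite !expnSr -!mulnA; apply: (@leq_trans (K ^ d * (l * h + K))).
      by rewrite mulnDr leq_add2r leq_mul2r hpow ?orbT// ltnW.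
    by rewrite leq_mul2l hl orbT.
  have h2 : (e * (s ^ d + 2) * h <= K ^ d.+1)%N.
    apply: (@leq_trans (e * (3 * 13 ^ d * K ^ d) * h)).
      by rewrite leq_mul2r leq_mul2l sb !orbT.
    rewrite (_ : e * (3 * 13 ^ d * K ^ d) * h = e * C * K ^ d)%N; last by rewrite /C; ring.
    by rewrite expnS leq_mul2r eK orbT.
  by apply: leq_trans h1; rewrite addnC leq_add2l.
have sn : (s <= n)%N.
  rewrite -(leq_exp2r _ _ d0); apply: leq_trans hn1.
  apply: (@leq_trans (2 ^ e)).
    by apply: leq_trans hs; rewrite hpow// leq_pmull.
  rewrite leq_exp2l//; apply: leq_trans hexpo.
  by rewrite mulnDr; nia.
have N2 : (1 < n ^ d)%N.
  by apply: leq_trans hn1; rewrite -{1}(expn1 2) leq_exp2l// expn_gt0; lia.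
have H1 : (2 * (2 ^ (l + 2) * M * 6 ^ d) < 2 ^ (2 * K))%N.
  rewrite (_ : 2 * (2 ^ (l + 2) * M * 6 ^ d) = 2 ^ l * (8 * M * 6 ^ d))%N; last first.
    by rewrite expnD; ring.
  apply: (@leq_ltn_trans (2 ^ l * 2 ^ e)).
    rewrite leq_mul2l; apply/orP; right; apply: leq_trans hexp.
    apply: (@leq_trans (8 * (9 * K.+1 ^ d.+1) * 26 ^ d)).
      by rewrite leq_mul ?hpow// leq_mul2l/= /M; move: (K.+1 ^ d.+1)%N hS => x; lia.
    rewrite (_ : 8 * (9 * K.+1 ^ d.+1) * 26 ^ d = 72 * 26 ^ d * K.+1 ^ d.+1)%N; last by ring.
    by rewrite !leq_mul.
  have eK' : (e <= K)%N by exact: leq_div.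
  by rewrite -expnD ltn_exp2l//; lia.
have H2 : ((16 * s ^ d) ^ (s ^ d) * 2 ^ (l ^ d.+1) * M <= (n %/ s) ^ d)%N.
  have s2 : (0 < (2 * s) ^ d)%N by rewrite expn_gt0 muln_gt0 /s addn1.
  rewrite -(leq_pmul2r s2).
  apply: (@leq_trans (n ^ d)); last first.
    rewrite -expnMn hpow// mulnCA mul2n -addnn.
    have s0 : (0 < s)%N by rewrite /s addn1.
    have := ltn_ceil n s0; rewrite mulSn => h1.
    by apply: leq_trans (ltnW h1) _; rewrite leq_add2r leq_pmull// divn_gt0.
  apply: leq_trans hn1; apply: (@leq_trans ((2 ^ e) ^ (s ^ d) * 2 ^ l ^ d.+1 * 2 ^ e * 2 ^ e)).
    rewrite !leq_mul// leq_exp2r// expn_gt0 /s addn1 //.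
  rewrite -expnM -!expnD leq_exp2l//; apply: leq_trans hexpo.
  by rewrite mulnDr; lia.
apply: le_trans (prob_solvable_grid_le R d0 N2 ht H1 H2) _.
have hlN : (2 ^ l <= n ^ d)%N.
  apply: leq_trans hn1; rewrite leq_exp2l// (leq_trans (ltnW lK))//.
  by rewrite expnS leq_pmulr.
have h3 : (n ^ d + t <= (n ^ d) ^ 3)%N.
  apply: leq_trans (leq_add (leqnn _) ht) _; move: hlN N2.
  move: (2 ^ l)%N (n ^ d)%N => x N xN N2; apply: (@leq_trans (N + N * N)).
    by rewrite leq_add2l leq_mul2l xN orbT.
  apply: (@leq_trans (2 * (N * N))).
    by rewrite mul2n -addnn leq_add2r leq_pmulr// ltnW.
  by rewrite expnS leq_mul// mulnn.
have h4 : ((n ^ d).+1 <= (n ^ d) ^ 2)%N.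
  rewrite expnS expn1 (leq_trans _ (leq_mul N2 (leqnn _)))//.
  by rewrite mul2n -addnn -addn1 leq_add2l ltnW.
have h5 : ((n ^ d + t) ^ 2 * (n ^ d).+1 <= 2 ^ (8 * K.+1 ^ d.+1))%N.
  apply: (@leq_trans (((n ^ d) ^ 3) ^ 2 * (n ^ d) ^ 2)); first by rewrite leq_mul// leq_exp2r.
  move: (n ^ d)%N hn2 => N hN2.
  by rewrite -expnM -expnD [(8 * _)%N]mulnC expnM leq_exp2r.
rewrite mulrA -natrX -natrM exprS mulrCA ler_piMr ?invr_ge0//.
by rewrite exprVn ler_pdivrMr ?exprn_gt0// mul1r -natrX ler_nat.
Qed.

(** * Translation to [grid_bound] *)

Lemma lg_ge0 (R : realType) (N : nat) : (0 < N)%N -> 0 <= lg (N%:R : R).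
Proof. by move=> N0; rewrite divr_ge0// ln_ge0 ?ler1n. Qed.

Lemma powR2_lg (R : realType) (x : R) : 0 < x -> 2 `^ lg x = x.
Proof.
move=> x0; rewrite /powR pnatr_eq0/= /lg mulfVK ?lnK//.
by rewrite gt_eqF// ln_gt0// ltr1n.
Qed.

Lemma truncn_lg_root (R : realType) (D N : nat)
    (K := Num.truncn ((lg N%:R : R) `^ (D.+1%:R)^-1)) : (0 < N)%N ->
  (2 ^ K ^ D.+1 <= N)%N && (N <= 2 ^ K.+1 ^ D.+1)%N.
Proof.
move=> N0; rewrite {}/K; set L := (lg N%:R : R) `^ (D.+1%:R)^-1.
set K := Num.truncn L.
have L0 : 0 <= L by exact: powR_ge0.
have LE : L ^+ D.+1 = lg N%:R.
  by rewrite -powR_mulrn// -powRrM mulVf ?pnatr_eq0// powRr1// lg_ge0.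
have NE : N%:R = 2 `^ (L ^+ D.+1) :> R by rewrite LE powR2_lg// ltr0n.
have /andP[KL LK] := truncn_itv L0; rewrite -/K in KL LK.
have E k : 2 `^ (k%:R ^+ D.+1) = (2 ^ k ^ D.+1)%:R :> R.
  by rewrite -natrX powR_mulrn// -natrX.
rewrite -!(ler_nat R) NE -!E; apply/andP; split; apply: ler_powR; rewrite ?ler1n//.
  by rewrite lerXn2r ?nnegrE.
by rewrite lerXn2r ?nnegrE ?ler0n// ltW.
Qed.

Lemma truncn_lg_root_ge (R : realType) (D N k : nat) : (2 ^ k.+1 ^ D.+1 <= N)%N ->
  (k <= Num.truncn ((lg N%:R : R) `^ (D.+1%:R)^-1))%N.
Proof.
move=> hk; have N0 : (0 < N)%N by apply: leq_trans hk; rewrite expn_gt0.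
have /andP[_ h] := truncn_lg_root R D N0.
by have := leq_trans hk h; rewrite leq_exp2l// leq_exp2r.
Qed.

Lemma prob_solvable_ge_of_grid_bound (R : realType) (d : nat) (c : R) :
  (0 < d)%N -> d%:R + 1 < c ->
  exists n0, forall n y, (n0 <= n)%N -> grid_bound d c (n ^ d) <= y ->
    1 / 2 <= prob_solvable (grid d n) R (Num.truncn y).
Proof.
(* For [L >= k] the exponent [d.+1 * K.+1 + 1] is at most [c * L]; the added 2 ensures
   [K.+1 < 2 ^ K], hence [K.+1 < n]. *)
move=> d0 hc; pose k := (Num.bound ((d%:R + 2) / (c - (d%:R + 1))) + 2)%N.
exists (2 ^ k.+1 ^ d.+1)%N => n y hn hy.
have n0 : (0 < n)%N by apply: leq_trans hn; rewrite expn_gt0.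
have N0 : (0 < n ^ d)%N by rewrite expn_gt0 n0.
have nN : (n <= n ^ d)%N by rewrite -{1}[n]expn1 leq_pexp2l.
have /andP[K1 K2] := truncn_lg_root R d N0.
have kK := truncn_lg_root_ge R (leq_trans hn nN).
have /andP[KL _] := truncn_itv (powR_ge0 (lg (n ^ d)%:R : R) (d.+1%:R)^-1).
rewrite /grid_bound in hy.
set L := (lg (n ^ d)%:R : R) `^ (d.+1%:R)^-1 in hy K1 K2 kK KL.
set K := Num.truncn L in K1 K2 kK KL.
have K2' : (2 <= K)%N by apply: leq_trans kK; rewrite /k leq_addl.
apply: (@prob_solvable_grid_ge R d n K.+1) => //.
  rewrite ltnNge; apply/negP => nK; move: K1; apply/negP; rewrite -ltnNge.
  apply: (@leq_ltn_trans (K.+1 ^ d)); first by rewrite leq_exp2r.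
  apply: (@leq_trans ((2 ^ K) ^ d)).
    rewrite ltn_exp2r//; move: K2'; case: (K) => // K'; elim: K' => // -[|K'] // IH _.
    by rewrite expnS; have := IH isT; lia.
  rewrite -expnM leq_exp2l// expnS leq_mul2l; apply/orP; right.
  by apply: leq_trans (ltnW (ltn_expl d (ltnSn 1))) _; rewrite leq_exp2r.
have y0 : 0 <= y by apply: le_trans hy; rewrite mulr_ge0// powR_ge0.
rewrite truncn_ge_nat//; apply: le_trans hy.
rewrite natrM ler_wpM2l// natrX -powR_mulrn// ler_powR ?ler1n//.
have hL : k%:R <= L by rewrite (le_trans _ KL)// ler_nat.
have hcL : d%:R + 2 <= (c - (d%:R + 1)) * L.
  rewrite -ler_pdivrMl ?subr_gt0// mulrC; apply: le_trans hL.
  apply: le_trans (ltW (archi_boundP _)) _; last by rewrite ler_nat /k leq_addr.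
  by apply: divr_ge0; [rewrite addr_ge0|rewrite subr_ge0 ltW].
have : (d%:R + 1) * K%:R <= (d%:R + 1) * L by rewrite ler_wpM2l// addr_ge0.
rewrite natrD natrM -!natr1; lra.
Qed.

Lemma prob_solvable_le_of_grid_bound (R : realType) (d : nat) (c : R) :
  (0 < d)%N -> c < 1 ->
  exists n0, forall n y, (n0 <= n)%N -> y <= grid_bound d c (n ^ d) ->
    prob_solvable (grid d n) R (Num.truncn y) <= 2^-1.
Proof.
(* Of the slack [2 / h], one half gives [l * h + K <= K * h], the other absorbs the rounding of [K]
   and [l]. *)
move=> d0 hc; pose h := (Num.bound (2 / (1 - c))).+2.
have h0 : 0 < h%:R :> R by rewrite ltr0n.
have hch : c <= 1 - 2 / h%:R.
  rewrite lerBrDr -lerBrDl ler_pdivrMr// mulrC -ler_pdivrMr ?subr_gt0//.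
  apply: le_trans (ltW (archi_boundP _)) _; last by rewrite ler_nat /h; do 2!apply: leqW.
  by rewrite divr_ge0// subr_ge0 ltW.
have [K0 hK0] := @prob_solvable_grid_le_half R d h d0 isT.
pose k := (K0 + 2 * h)%N.
exists (2 ^ k.+1 ^ d.+1)%N => n y hn hy.
have n0 : (0 < n)%N by apply: leq_trans hn; rewrite expn_gt0.
have N0 : (0 < n ^ d)%N by rewrite expn_gt0 n0.
have nN : (n <= n ^ d)%N by rewrite -{1}[n]expn1 leq_pexp2l.
have /andP[K1 K2] := truncn_lg_root R d N0.
have kK := truncn_lg_root_ge R (leq_trans hn nN).
have /andP[KL LK] := truncn_itv (powR_ge0 (lg (n ^ d)%:R : R) (d.+1%:R)^-1).
rewrite /grid_bound in hy.
set L := (lg (n ^ d)%:R : R) `^ (d.+1%:R)^-1 in hy K1 K2 kK KL LK.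
set K := Num.truncn L in K1 K2 kK KL LK.
have hK : (2 * h <= K)%N by apply: leq_trans kK; rewrite /k leq_addl.
pose l := (K - (K %/ h).+1)%N.
have hKh : ((K %/ h).+1 <= K)%N.
  have : (K %/ h * 2 <= K)%N.
    by apply: leq_trans (leq_divM K h); rewrite leq_mul2l /h orbT.
  move: hK; rewrite /h; lia.
apply: (hK0 K n l) => //.
- by apply: leq_trans kK; rewrite /k leq_addr.
- have := ltn_ceil K (isT : 0 < h)%N; rewrite /l mulnBl.
  have : ((K %/ h).+1 * h <= K * h)%N by rewrite leq_mul2r hKh orbT.
  move: (K * h)%N (_.+1 * h)%N => A B; lia.
- rewrite -(@Num.Theory.natrK R (n ^ d * 2 ^ l)); apply: le_truncn; apply: le_trans hy _.
  rewrite natrM ler_wpM2l// natrX -powR_mulrn// ler_powR ?ler1n//.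
  have L0 : 0 <= L by exact: powR_ge0.
  have e1 : c * L <= (1 - 2 / h%:R) * L by rewrite ler_wpM2r.
  have e2 : 2 <= L / h%:R.
    by rewrite ler_pdivlMr// -natrM (le_trans _ KL)// ler_nat.
  have e3 : (K %/ h)%:R <= L / h%:R.
    by rewrite ler_pdivlMr// -natrM (le_trans _ KL)// ler_nat leq_divM.
  have -> : l%:R = K%:R - (K %/ h)%:R - 1 :> R by rewrite natrB// -natr1; ring.
  move: e1 LK; rewrite -natr1 mulrBl mul1r mulrAC -mulrA; lra.
Qed.

(** * From probability bounds to thresholds *)

(** Along a strictly increasing [a] with [P i (a i)], let [w N] be the largest [i] with [a i <= N];
    then [w] is unbounded and [w (a i) = i]. *)
Lemma diagonal_growth (P : nat -> nat -> Prop) :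
  (forall i m, exists N, (m <= N)%N /\ P i N) ->
  exists w : nat -> nat, (forall k, exists m, forall N, (m <= N)%N -> (k <= w N)%N) /\
    (forall m, exists N, (m <= N)%N /\ P (w N) N).
Proof.
move=> h; have {h}/choice[f hf] (p : nat * nat) : exists N, (p.2 <= N)%N /\ P p.1 N.
  exact: h.
pose a := fix a i := if i is j.+1 then f (j.+1, (a j).+1) else f (0, 0)%N.
have Pa i : P i (a i) by case: i => [|i] /=; [case: (hf (0, 0)%N)|case: (hf (i.+1, (a i).+1))].
have aS i : (a i < a i.+1)%N by case: (hf (i.+1, (a i).+1)).
have a_lt i j : (i < j)%N -> (a i < a j)%N.
  exact: (homo_ltn ltn_trans aS).
have ia i : (i <= a i)%N by elim: i => // i IH; exact: leq_ltn_trans IH (aS i).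
pose w N := (\max_(i < N.+1 | (a i <= N)%N) i)%N.
have wge k N : (a k <= N)%N -> (k <= w N)%N.
  move=> hk; have kN : (k < N.+1)%N by rewrite ltnS (leq_trans (ia k)).
  exact: (@leq_bigmax_cond _ (fun i : 'I_N.+1 => (a i <= N)%N) _ (Ordinal kN)).
exists w; split=> [k|m]; first by exists (a k) => N; exact: wge.
exists (a m); split; first exact: ia.
suff -> : w (a m) = m by exact: Pa.
apply/eqP; rewrite eqn_leq wge// andbT; apply/bigmax_leqP => i hi.
by rewrite leqNgt; apply/negP => /a_lt; rewrite ltnNge hi.
Qed.

Lemma cvgry_nat (R : realType) (w : nat -> nat) :
  (forall k, exists m, forall N, (m <= N)%N -> (k <= w N)%N) ->
  (w N).+1%:R @[N --> \oo] --> (+oo : set_system R).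
Proof.
move=> h; apply/cvgryPge => A; have [m hm] := h (Num.bound `|A|).
exists m => // N /= /hm hN; apply: le_trans (ler_norm A) _.
by rewrite (le_trans (ltW (archi_boundP (normr_ge0 A))))// ler_nat leqW.
Qed.

Theorem theorem10 (R : realType) (d : nat) (hd : (0 < d)%N) (tau : nat -> R)
    (htau : pebbling_threshold (grid d) tau)
    (c c' : R) (hc : c < 2 `^ (- (2 * d%:R)^-1)) (hc' : d%:R + 1 < c') :
  (fun n : nat => tau (n ^ d)%N) =Omega_\oo (fun n : nat => grid_bound d c (n ^ d)%N)
  /\ (fun n : nat => tau (n ^ d)%N) =O_\oo (fun n : nat => grid_bound d c' (n ^ d)%N).
Proof.
have c1 : c < 1.
  apply: lt_le_trans hc _; rewrite powRN invf_le1 ?powR_gt0//.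
  rewrite -[leLHS](powRr0 2); apply: ler_powR; first by rewrite ler1n.
  by rewrite invr_ge0 mulr_ge0.
have [n0 hlow] := prob_solvable_le_of_grid_bound hd c1.
have [n1 hupp] := prob_solvable_ge_of_grid_bound hd hc'.
have g0 e N : 0 <= grid_bound d e N :> R by rewrite mulr_ge0// powR_ge0.
have nN n : (n <= n ^ d)%N.
  by case: n => // n; rewrite -[X in (X <= _)%N]expn1 leq_pexp2l.
(* Where [tau] is nonpositive, [omega * tau] lies below the lower bound, which contradicts the limit
   1. *)
have [n2 hpos] : exists n2, forall n, (n2 <= n)%N -> 0 < tau (n ^ d)%N.
  have [_ /cvgr_gt/(_ 2^-1)] := htau (fun N => N%:R) (@cvgr_idn R).
  case; first by rewrite invf_lt1// ltr1n.
  move=> m _ hm; exists (maxn m n0) => n; rewrite geq_max => /andP[mn nn].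
  rewrite ltNge; apply/negP => tau0; have := hm n mn; rewrite /= card_grid ltNge.
  by rewrite hlow// (le_trans (mulr_ge0_le0 _ tau0)).
split.
  rewrite eqOmegaE eqOmegaO; apply/eqO_exP; apply: contrapT => hO.
  (* If the bound fails for every constant, [omega = w + 1] keeps [omega * tau] below
     [grid_bound d c] infinitely often, against the limit 1. *)
  pose P i N := exists n, [/\ N = (n ^ d)%N, (n0 <= n)%N &
    i.+1%:R * `|tau N| <= `|grid_bound d c N|].
  have /diagonal_growth[w [wy hw]] i m : exists N, (m <= N)%N /\ P i N.
    apply: contrapT => hN; apply: hO; exists i.+1%:R; first by rewrite ltr0n.
    exists (maxn m n0) => // n /=; rewrite geq_max => /andP[mn nn].
    rewrite leNgt; apply/negP => h; apply: hN; exists (n ^ d)%N; split.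
      exact: leq_trans (nN n).
    by exists n; split=> //; exact: ltW.
  have [_ /cvgr_gt/(_ 2^-1)] := htau _ (cvgry_nat wy).
  case; first by rewrite invf_lt1// ltr1n.
  move=> m _ hm; have [N [mN [n [eN nn hn]]]] := hw (m ^ d)%N.
  have mn : (m <= n)%N by move: mN; rewrite eN leq_exp2r.
  have := hm n mn; rewrite /= card_grid ltNge hlow// -eN.
  rewrite (ger0_norm (g0 c N)) in hn; apply: le_trans hn.
  by rewrite ler_wpM2l// ler_norm.
apply/eqO_exP; apply: contrapT => hO.
(* Symmetrically, [tau / omega] stays above [grid_bound d c'] infinitely often, against the limit 0;
   [n2] makes [tau] positive there. *)
pose P i N := exists n, [/\ N = (n ^ d)%N, (n1 <= n)%N, (n2 <= n)%N &
  i.+1%:R * `|grid_bound d c' N| <= `|tau N|].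
have /diagonal_growth[w [wy hw]] i m : exists N, (m <= N)%N /\ P i N.
  apply: contrapT => hN; apply: hO; exists i.+1%:R; first by rewrite ltr0n.
  exists (maxn m (maxn n1 n2)) => // n /=; rewrite !geq_max => /and3P[mn nn nn'].
  rewrite leNgt; apply/negP => h; apply: hN; exists (n ^ d)%N; split.
    exact: leq_trans (nN n).
  by exists n; split=> //; exact: ltW.
have [/cvgr_lt/(_ (1 / 2)) + _] := htau _ (cvgry_nat wy).
case; first by rewrite divr_gt0.
move=> m _ hm; have [N [mN [n [eN nn nn' hn]]]] := hw (m ^ d)%N.
have mn : (m <= n)%N by move: mN; rewrite eN leq_exp2r.
have := hm n mn; rewrite /= card_grid ltNge hupp// -eN.
rewrite ler_pdivlMr ?ltr0n// mulrC.
move: hn; rewrite (ger0_norm (g0 c' N)) [`|tau N|]ger0_norm// eN.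
exact/ltW/hpos.
Qed.
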